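(* Suppose that $X_1,\ldots,X_n$ are random variables such that $0\le X_i\le 1$ for $i=1,\ldots,n$. Assume further that there exist constants $\gamma\in(0,1)$ and $\delta\in(0,1]$ such that for all $A\subseteq[n]$ $$\mathbb{E}[Z_A]\le \gamma^{|A|}\cdot\delta^{\,n-|A|},\qquad\text{where } Z_A=\prod_{i\in A}X_i\prod_{i\in[n]\setminus A}(1-X_i)$$ and $|A|$ denotes the cardinality of $A$. Fix a real number $\varepsilon\in\left(0,\frac1\gamma-1\right)$ and set $t=n\gamma+n\gamma\varepsilon$. Then $$\mathbb{P}\left[\sum_{i=1}^nX_i\ge t\right]\le \gamma^t\delta^{\,n-t}\left(\frac{n-t}{t}\right)^t\left(\frac{n}{n-t}\right)^n .$$ Furthermore, $$\gamma^t\delta^{\,n-t}\left(\frac{n-t}{t}\right)^t\left(\frac{n}{n-t}\right)^n\le e^{-n\left\{D(\gamma(1+\varepsilon)\|\gamma)-(1-\gamma(1+\varepsilon))\ln\frac{\delta}{1-\gamma}\right\}}.$$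
   Context: The random variables are defined on a common probability space and may be dependent. $[n]=\{1,\ldots,n\}$. Empty products equal $1$. For $q,p\in(0,1)$, $D(q\|p)=q\ln\frac qp+(1-q)\ln\frac{1-q}{1-p}$ is the Kullback-Leibler distance. *)

(* Defs.v *)
From HB Require Import structures.
From mathcomp Require Import all_boot all_order all_algebra.
From mathcomp Require Import all_classical all_reals all_analysis.

Set Implicit Arguments.
Unset Strict Implicit.
Unset Printing Implicit Defensive.

Import Order.TTheory GRing.Theory Num.Theory.

Local Open Scope ring_scope.

(* Kullback-Leibler distance between Bernoulli(q) and Bernoulli(p); intended
   for q and p in ]0, 1[. *)
Definition KL (R : realType) (q p : R) : R :=
  q * ln (q / p) + (1 - q) * ln ((1 - q) / (1 - p)).

Definition Zprod (T : Type) (R : realType) (n : nat) (X : 'I_n -> T -> R)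
    (A : {set 'I_n}) (w : T) : R :=
  (\prod_(i in A) X i w) * (\prod_(i in ~: A) (1 - X i w)).

(* Main.v *)
Require Import Defs.
From HB Require Import structures.
From mathcomp Require Import all_boot all_order all_algebra.
From mathcomp Require Import all_classical all_reals all_analysis.
From mathcomp Require Import measurable_realfun ring lra.

Set Implicit Arguments.
Unset Strict Implicit.
Unset Printing Implicit Defensive.

Import Order.TTheory GRing.Theory Num.Theory.

Local Open Scope ring_scope.

(** The proof is Chernoff's method, with the product structure that
independence would give replaced by the hypothesis on the [Zprod X A].

For [lam > 0] convexity of [x |-> lam `^ x] bounds it on the unit interval by
its chord [1 - x + lam * x]; multiplying over [i] and expanding the product
over the subsets [A] of the index set gives
[lam `^ (\sum_i X i) <= \sum_A lam ^+ #|A| * Zprod X A]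
([powR_sum_le_prod_chord], [prod_chordE]).  The hypothesis and the binomial
theorem then bound the exponential moment by [(lam * gamma + delta) ^+ n]
([expectation_prod_chord_le]), and for [lam >= 1] Markov's inequality gives the
tail bound [lam `^ (- t) * (lam * gamma + delta) ^+ n] ([chernoff_tail]).

As a function of [lam] this is smallest at
[lam = t * delta / (gamma * (n - t))], where it equals the claimed bound
([optimal_tailE]).  That this value is at least 1 comes from
[gamma + delta >= 1] ([sum_bounds_ge1]): the [Zprod X A] sum to 1, so their
expectations do, while the bounds on these sum to [(gamma + delta) ^+ n].

The second inequality is in fact an equality, seen by taking logarithms
([tail_bound_KL]). *)

(** * The chord bound and its multilinear expansion *)

Lemma powR_le_chord (R : realType) (lam x : R) : 0 < lam -> 0 <= x <= 1 ->
  lam `^ x <= 1 - x + lam * x.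
Proof.
move=> lam0 /andP[x0 x1]; rewrite /powR gt_eqF//.
have := convex_expR (Itv01 x0 x1) (ln lam) 0.
by rewrite !convRE /= expR0 lnK// !mulr0 addr0 mulr1 addrC mulrC [lam * _]mulrC.
Qed.

Lemma powR_sum (R : realType) (I : Type) (r : seq I) (lam : R) (x : I -> R) :
  0 < lam -> lam `^ (\sum_(i <- r) x i) = \prod_(i <- r) lam `^ (x i).
Proof.
move=> lam0; elim/big_rec2: _ => [|i y1 y2 _ <-]; first by rewrite powRr0.
by rewrite powRD// (gt_eqF lam0) implybT.
Qed.

Lemma powR_sum_le_prod_chord (R : realType) (n : nat) (lam : R)
    (x : 'I_n -> R) : 0 < lam -> (forall i, 0 <= x i <= 1) ->
  lam `^ (\sum_(i < n) x i) <= \prod_(i < n) (1 - x i + lam * x i).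
Proof.
move=> lam0 x01; rewrite powR_sum//; apply: ler_prod => i _.
by rewrite powR_ge0 powR_le_chord.
Qed.

Lemma prodrD_subsets (R : comPzRingType) (n : nat) (F G : 'I_n -> R) :
  \prod_(i < n) (F i + G i) =
  \sum_(A : {set 'I_n}) (\prod_(i in A) F i) * (\prod_(i in ~: A) G i).
Proof.
rewrite bigA_distr; apply: eq_bigr => A _.
rewrite (bigID (mem A))/=; congr (_ * _); first by apply: eq_bigr => i ->.
by apply: eq_big => [i|i /negbTE ->//]; rewrite inE.
Qed.

Lemma prod_chordE (R : realType) (T : Type) (n : nat) (lam : R)
    (X : 'I_n -> T -> R) (w : T) :
  \prod_(i < n) (1 - X i w + lam * X i w) =
  \sum_(A : {set 'I_n}) lam ^+ #|A| * Zprod X A w.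
Proof.
under eq_bigr do rewrite addrC.
rewrite prodrD_subsets; apply: eq_bigr => A _.
by rewrite /Zprod mulrA -prodr_const -big_split.
Qed.

Lemma sum_subsets_powers (R : comPzRingType) (n : nat) (a b : R) :
  \sum_(A : {set 'I_n}) a ^+ #|A| * b ^+ (n - #|A|) = (a + b) ^+ n.
Proof.
have -> : (a + b) ^+ n = \prod_(i < n) (a + b) by rewrite prodr_const card_ord.
rewrite prodrD_subsets; apply: eq_bigr => A _.
by rewrite !prodr_const (cardsCs (~: A)) finset.setCK card_ord.
Qed.

(** * Moment and tail bounds *)

Lemma measurable_Zprod (R : realType) (d : measure_display)
    (T : measurableType d) (n : nat) (X : 'I_n -> T -> R) (A : {set 'I_n}) :
  (forall i, measurable_fun [set: T] (X i)) ->
  measurable_fun [set: T] (Zprod X A).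
Proof.
move=> mX; have mprod (B : {set 'I_n}) (h : 'I_n -> T -> R) :
    (forall i, measurable_fun [set: T] (h i)) ->
    measurable_fun [set: T] (fun w => \prod_(i in B) h i w).
  move=> mh; under eq_fun do rewrite -big_enum.
  by apply: measurable_prod => i _; exact: mh.
apply: measurable_funM; apply: mprod => // i.
exact: measurable_funB.
Qed.

Lemma Zprod_ge0 (R : realType) (T : Type) (n : nat) (X : 'I_n -> T -> R)
    (A : {set 'I_n}) (w : T) :
  (forall i, 0 <= X i w <= 1) -> 0 <= Zprod X A w.
Proof.
move=> X01; apply: mulr_ge0; apply: prodr_ge0 => i _.
  by have /andP[] := X01 i.
by rewrite subr_ge0; have /andP[] := X01 i.
Qed.

(** The hypothesis is used term by term on the expansion [prod_chordE]; the
bounds resum by the binomial theorem. *)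
Lemma expectation_prod_chord_le (R : realType) (d : measure_display)
    (T : measurableType d) (P : probability T R) (n : nat)
    (X : 'I_n -> {RV P >-> R}) (gamma delta lam : R) :
  (forall i w, 0 <= X i w <= 1) ->
  (forall A : {set 'I_n}, ('E_P[Zprod (fun i w => X i w) A]
     <= (gamma ^+ #|A| * delta ^+ (n - #|A|)%N)%:E)%E) ->
  0 <= lam ->
  ('E_P[fun w => (\prod_(i < n) (1 - X i w + lam * X i w))%R]
     <= ((lam * gamma + delta) ^+ n)%:E)%E.
Proof.
move=> X01 EZ lam0.
have mZ A : measurable_fun [set: T] (Zprod (fun i w => X i w) A).
  by apply: measurable_Zprod => i; exact: measurable_funPT.
under eq_fun do rewrite (prod_chordE lam (fun i w => X i w)).
rewrite unlock /=; under eq_integral do rewrite -sumEFin.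
rewrite ge0_integral_sum//=; last 2 first.
- by move=> A; apply/measurable_EFinP; exact: measurable_funM.
- by move=> A w _; rewrite lee_fin mulr_ge0 ?exprn_ge0// Zprod_ge0.
rewrite -sum_subsets_powers -sumEFin; apply: lee_sum => A _.
under eq_integral do rewrite EFinM.
rewrite ge0_integralZl_EFin//=; last 3 first.
- by move=> w _; rewrite lee_fin Zprod_ge0.
- exact/measurable_EFinP.
- exact: exprn_ge0.
rewrite exprMn -mulrA EFinM lee_wpmul2l ?lee_fin ?exprn_ge0//.
by have := EZ A; rewrite unlock.
Qed.

(** The case [lam = 1] of the moment bound, where the product is 1. *)
Lemma sum_bounds_ge1 (R : realType) (d : measure_display)
    (T : measurableType d) (P : probability T R) (n : nat)
    (X : 'I_n -> {RV P >-> R}) (gamma delta : R) :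
  (0 < n)%N -> 0 <= gamma + delta ->
  (forall i w, 0 <= X i w <= 1) ->
  (forall A : {set 'I_n}, ('E_P[Zprod (fun i w => X i w) A]
     <= (gamma ^+ #|A| * delta ^+ (n - #|A|)%N)%:E)%E) ->
  1 <= gamma + delta.
Proof.
move=> n0 gd0 X01 EZ.
have := expectation_prod_chord_le X01 EZ ler01.
under eq_fun => w do under eq_bigr do rewrite mul1r subrK.
under eq_fun do rewrite big1_eq.
by rewrite (expectation_cst P 1) lee_fin mul1r expr_gte1.
Qed.

(** On the event, [lam >= 1] gives [lam `^ t <= lam `^ (\sum_i X i w)], so
[lam `^ t] times its indicator lies below the chord product everywhere. *)
Lemma chernoff_tail (R : realType) (d : measure_display)
    (T : measurableType d) (P : probability T R) (n : nat)
    (X : 'I_n -> {RV P >-> R}) (gamma delta lam t : R) :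
  (forall i w, 0 <= X i w <= 1) ->
  (forall A : {set 'I_n}, ('E_P[Zprod (fun i w => X i w) A]
     <= (gamma ^+ #|A| * delta ^+ (n - #|A|)%N)%:E)%E) ->
  1 <= lam ->
  (P [set w : T | (t <= \sum_(i < n) X i w)%R]%classic
     <= (lam `^ (- t) * (lam * gamma + delta) ^+ n)%:E)%E.
Proof.
move=> X01 EZ lam1; have lam0 : 0 < lam by apply: lt_le_trans lam1.
set S := [set w | _]%classic.
have mX i : measurable_fun [set: T] (X i) by exact: measurable_funPT.
have mS : measurable S.
  rewrite -[S]setTI.
  apply: (@measurable_fun_le _ _ _ _ (cst t)
    (fun w => \sum_(i < n) X i w)) => //.
  exact: measurable_sum.
have mG : measurable_fun [set: T]
    (fun w => \prod_(i < n) (1 - X i w + lam * X i w)).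
  apply: measurable_prod => i _; apply: measurable_funD => //.
    exact: measurable_funB.
  exact: measurable_funM.
have G0 w : 0 <= \prod_(i < n) (1 - X i w + lam * X i w).
  by apply: le_trans (powR_sum_le_prod_chord lam0 (X01 ^~ w)); exact: powR_ge0.
rewrite powRN mulrC EFinM lee_pdivlMr ?powR_gt0//.
apply: le_trans (expectation_prod_chord_le X01 EZ (ltW lam0)).
rewrite -expectation_indic// unlock muleC -ge0_integralZl_EFin//=; last 2 first.
- by apply/measurable_EFinP; exact: measurable_indic.
- exact: powR_ge0.
apply: ge0_le_integral => //=.
- by move=> w _; rewrite lee_fin mulr_ge0 ?powR_ge0.
- by apply/measurable_EFinP; exact: measurable_funM.
- exact/measurable_EFinP.
move=> w _; rewrite lee_fin indicE; have [wS|_] := boolP (w \in S).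
  rewrite mulr1 (le_trans _ (powR_sum_le_prod_chord lam0 (X01 ^~ w)))//.
  by apply: ler_powR => //; rewrite inE in wS.
by rewrite mulr0.
Qed.

(** * The optimal parameter *)

Lemma powR_expR (R : realType) (x r : R) : 0 < x -> x `^ r = expR (r * ln x).
Proof. by move=> x0; rewrite /powR gt_eqF. Qed.

Lemma exprn_expR (R : realType) (x : R) (n : nat) :
  0 < x -> x ^+ n = expR (n%:R * ln x).
Proof. by move=> x0; rewrite -powR_mulrn ?ltW// powR_expR. Qed.

(** [lam] is the zero of the derivative of
[- t * ln lam + n * ln (lam * gamma + delta)]; for it [lam * gamma + delta]
simplifies to [delta * n / (n - t)]. *)
Lemma optimal_tailE (R : realType) (n : nat) (gamma delta t : R) :
  0 < gamma -> 0 < delta -> 0 < t < n%:R ->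
  let lam := t * delta / (gamma * (n%:R - t)) in
  lam `^ (- t) * (lam * gamma + delta) ^+ n =
  gamma `^ t * delta `^ (n%:R - t) * ((n%:R - t) / t) `^ t
    * (n%:R / (n%:R - t)) ^+ n.
Proof.
move=> g0 d0 /andP[t0 tn] lam.
have n0 : 0 < n%:R :> R by apply: lt_trans tn.
have nt0 : 0 < n%:R - t by rewrite subr_gt0.
have -> : lam * gamma + delta = delta * (n%:R / (n%:R - t)).
  by rewrite /lam; field; rewrite !gt_eqF.
have lam0 : 0 < lam by rewrite divr_gt0 ?mulr_gt0.
rewrite !powR_expR ?divr_gt0 ?mulr_gt0// !exprn_expR ?mulr_gt0 ?invr_gt0//.
rewrite -!expRD /lam; congr expR.
rewrite [ln (delta * _)]lnM ?posrE ?divr_gt0//.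
rewrite !ln_div ?posrE ?mulr_gt0// !lnM ?posrE//.
ring.
Qed.

(** The logarithm of either side is
[n * (q * ln (gamma / q) + (1 - q) * ln (delta / (1 - q)))]. *)
Lemma tail_bound_KL (R : realType) (n : nat) (gamma delta q t : R) :
  (0 < n)%N -> 0 < gamma < 1 -> 0 < delta -> 0 < q < 1 -> t = n%:R * q ->
  gamma `^ t * delta `^ (n%:R - t) * ((n%:R - t) / t) `^ t
    * (n%:R / (n%:R - t)) ^+ n =
  expR (- (n%:R * (KL q gamma - (1 - q) * ln (delta / (1 - gamma))))).
Proof.
move=> n0 /andP[g0 g1] d0 /andP[q0 q1] ->.
have nR0 : 0 < n%:R :> R by rewrite ltr0n.
have -> : n%:R - n%:R * q = n%:R * (1 - q) by ring.
have q1' : 0 < 1 - q by rewrite subr_gt0.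
have g1' : 0 < 1 - gamma by rewrite subr_gt0.
rewrite !powR_expR ?divr_gt0 ?mulr_gt0// exprn_expR ?divr_gt0 ?mulr_gt0//.
rewrite -!expRD /KL; congr expR.
rewrite !ln_div ?posrE ?mulr_gt0// !lnM ?posrE//.
ring.
Qed.

Theorem theorem1p5 (R : realType) (d : measure_display) (T : measurableType d)
    (P : probability T R) (n : nat) (n_gt0 : (0 < n)%N)
    (X : 'I_n -> {RV P >-> R})
    (X01 : forall (i : 'I_n) (w : T), 0 <= X i w <= 1)
    (gamma delta : R) (gamma01 : 0 < gamma < 1) (delta01 : 0 < delta <= 1)
    (EZ : forall A : {set 'I_n},
      ('E_P[Zprod (fun i w => X i w) A]
         <= (gamma ^+ #|A| * delta ^+ (n - #|A|)%N)%:E)%E)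
    (epsilon : R) (epsilon_itv : 0 < epsilon < 1 / gamma - 1)
    (t : R) (tE : t = n%:R * gamma + n%:R * gamma * epsilon) :
  (P [set w : T | (t <= \sum_(i < n) X i w)%R]%classic
     <= (gamma `^ t * delta `^ (n%:R - t) * ((n%:R - t) / t) `^ t
           * (n%:R / (n%:R - t)) ^+ n)%:E)%E /\
  gamma `^ t * delta `^ (n%:R - t) * ((n%:R - t) / t) `^ t
      * (n%:R / (n%:R - t)) ^+ n
    <= expR (- (n%:R * (KL (gamma * (1 + epsilon)) gamma
                 - (1 - gamma * (1 + epsilon)) * ln (delta / (1 - gamma))))).
Proof.
have /andP[g0 g1] := gamma01; have /andP[d0 d1] := delta01.
have /andP[e0 e1] := epsilon_itv.
have nR0 : 0 < n%:R :> R by rewrite ltr0n.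
set q := gamma * (1 + epsilon).
have tq : t = n%:R * q by rewrite tE /q; ring.
have gq : gamma <= q by rewrite /q; nra.
have q1 : q < 1 by rewrite /q mulrC -ltr_pdivlMr// addrC -ltrBrDr.
have q0 : 0 < q by apply: lt_le_trans gq.
split; last by rewrite (tail_bound_KL n_gt0 gamma01 d0 _ tq) ?q0.
have t01 : 0 < t < n%:R by rewrite tq mulr_gt0//= gtr_pMr.
(* What remains after Markov's inequality is that the optimal parameter is at
   least 1. *)
rewrite -optimal_tailE//; apply: chernoff_tail => //.
have gd1 : 1 <= gamma + delta.
  by apply: sum_bounds_ge1 X01 EZ => //; rewrite addr_ge0 ?ltW.
have nt0 : 0 < n%:R - t by rewrite subr_gt0; case/andP: t01.
rewrite ler_pdivlMr ?mulr_gt0// mul1r tq.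
have -> : gamma * (n%:R - n%:R * q) = n%:R * (gamma * (1 - q)) by ring.
rewrite -mulrA ler_pM2l//.
(* delta >= 1 - gamma >= 1 - q and q >= gamma *)
nra.
Qed.
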